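(* Let $k$ be a field of characteristic $p$, $G$ a finite group, and $\Delta$ a weak synthetic building for $G$ at $p$. For each simple $kG$-module $S$, the multiplicity of the projective cover $P_S$ as a summand of $\tilde L(\Delta)$ equals $$\frac{\sum_{\sigma\in[\tilde\Delta/G]}(-1)^{\dim\sigma}\,\bigl(\text{multiplicity of }P_k\text{ for }G_\sigma\text{ in }S\downarrow_{G_\sigma}\bigr)}{\dim_k\operatorname{End}_{kG}(S)}.$$
   Context: A $G$-simplicial complex is a finite (possibly empty) simplicial complex $\Delta$ with a simplicial action of the finite group $G$ such that the setwise stabilizer of each simplex fixes that simplex pointwise. For $H\le G$, $\Delta^H$ denotes the fixed point subcomplex. Contractible spaces are non-empty. A $G$-simplicial complex $\Delta$ is a weak synthetic building for $G$ at the prime $p$ if $\Delta^P$ is $N_G(P)$-equivariantly contractible for every non-identity $p$-subgroup $P\le G$. $\tilde\Delta$ denotes $\Delta$ together with one extra simplex of dimension $-1$ whose stabilizer is $G$; $[\tilde\Delta/G]$ is a set of representatives of the $G$-orbits of simplices of $\tilde\Delta$; $G_\sigma$ is the stabilizer of $\sigma$. $\tilde C_\cdot(\Delta)$ is the augmented simplicial chain complex over $k$ (with $\tilde C_{-1}=k$). The reduced Lefschetz module is $\tilde L(\Delta)=\sum_{i\ge -1}(-1)^i\tilde C_i(\Delta)=\sum_{\sigma\in[\tilde\Delta/G]}(-1)^{\dim\sigma}k\uparrow_{G_\sigma}^G$ in the Green ring of finitely generated $kG$-modules (the free abelian group on isomorphism classes of indecomposable modules). It is a known theorem that for a weak synthetic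 building $\tilde L(\Delta)$ is a virtual projective module, i.e. $\tilde L(\Delta)=\sum_S n_S P_S$ with $n_S\in\mathbb Z$; the multiplicity of $P_S$ in $\tilde L(\Delta)$ means $n_S$. ''$P_k$ for $G_\sigma$'' is the projective cover of the trivial $kG_\sigma$-module $k$, and its multiplicity in $S\downarrow_{G_\sigma}$ is its multiplicity as a direct summand of the restriction of $S$ to $G_\sigma$. *)

(* Defs.v *)
(* As usual in MathComp, groups act on the right and a
   kG-module is a matrix representation acting on row vectors on the right.
   Both are interchanged with left actions and left modules by g |-> g^-1. *)
From HB Require Import structures.
From mathcomp Require Import all_boot all_order all_algebra all_fingroup.
From mathcomp Require Import all_solvable all_field all_character.
From mathcomp Require Import boolp classical_sets reals topology normedtype.
From mathcomp Require Import function_spaces subspace_topology.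

Set Implicit Arguments.
Unset Strict Implicit.
Unset Printing Implicit Defensive.

Import Order.TTheory GRing.Theory Num.Theory.
Import numFieldNormedType.Exports.

Local Open Scope ring_scope.

(* Elements of [gvertex] that do not form a singleton simplex are not
   vertices of the complex; they play no role. *)
Record Gcomplex (gT : finGroupType) (G : {group gT}) := GComplex {
  gvertex : finType;
  gact : action G gvertex;
  gsimplex : {set {set gvertex}};
  gsimplex_neq0 : forall s : {set gvertex}, s \in gsimplex -> s != finset.set0;
  gsimplex_sub : forall s t : {set gvertex},
    s \in gsimplex -> t \subset s -> t != finset.set0 -> t \in gsimplex;
  gsimplex_act : forall g (s : {set gvertex}),
    g \in G -> s \in gsimplex -> (gact^*)%act s g \in gsimplex;
  gsimplex_admissible : forall g (s : {set gvertex}) v,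
    g \in G -> s \in gsimplex -> (gact^*)%act s g = s -> v \in s -> gact v g = v
}.

Section Complexes.
Variables (gT : finGroupType) (G : {group gT}) (D : Gcomplex G).
Local Notation V := (gvertex D).
Local Notation to := (gact D).

(* The empty set of vertices is the extra simplex of dimension -1. *)
Definition tsimplex : {set {set V}} := finset.set0 |: gsimplex D.

Definition simplex_dim (s : {set V}) : int := #|s|%:Z - 1.

Definition simplex_stab (s : {set V}) : {group gT} := 'N_G(s | to)%G.

Lemma simplex_stab_sub (s : {set V}) : simplex_stab s \subset G.
Proof. exact: subsetIl. Qed.

Definition orbit_reps (X : {set {set V}}) : bool :=
  is_transversal X [set orbit (to^*) G s | s in tsimplex] tsimplex.

Definition fixed_subcomplex (H : {set gT}) : {set {set V}} :=
  [set s in gsimplex D | H \subset simplex_stab s].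

(* Barycentric coordinates, with the topology of R^V. *)
Definition realization (R : realType) (K : {set {set V}}) : set {ptws V -> R} :=
  [set x : {ptws V -> R} |
    [/\ forall v, 0 <= x v, \sum_v x v = 1 & [set v | x v != 0]%SET \in K]]%classic.

Definition point_act (R : realType) (x : {ptws V -> R}) (g : gT) :
  {ptws V -> R} := fun v => x (to v g^-1%g).

(* |K| is H-homotopy equivalent to a point: there is an H-homotopy from the
   identity of |K| to the constant map at an H-fixed point. *)
Definition equivariantly_contractible (R : realType) (H : {set gT})
    (K : {set {set V}}) : Prop :=
  exists (c : {ptws V -> R}) (h : {ptws V -> R} * R -> {ptws V -> R}),
    let I01 := [set t : R | 0 <= t <= 1]%classic in
    [/\ realization K c /\ (forall g, g \in H -> point_act c g = c),
        {within realization K `*` I01, continuous h}%classic,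
        forall x t, realization K x -> I01 t -> realization K (h (x, t)),
        forall x, realization K x -> h (x, 0) = x /\ h (x, 1) = c &
        forall g x t, g \in H -> realization K x -> I01 t ->
          h (point_act x g, t) = point_act (h (x, t)) g].

Definition weak_synthetic_building (R : realType) (p : nat) : Prop :=
  forall P : {group gT}, P \subset G -> (p.-group P)%g -> (P :!=: 1)%g ->
    equivariantly_contractible R 'N_G(P)%g (fixed_subcomplex P).

End Complexes.

Section Modules.
Variables (k : fieldType) (gT : finGroupType) (G : {group gT}).
Local Notation module := (representation k G).

Definition module_hom (M N : module) (f : 'M[k]_(rdegree M, rdegree N)) : Prop :=
  forall g, g \in G -> M g *m f = f *m N g.

Definition projective (P : module) : Prop :=
  forall (M N : module) (f : 'M[k]_(rdegree M, rdegree N))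
         (h : 'M[k]_(rdegree P, rdegree N)),
    module_hom f -> row_full f -> module_hom h ->
    exists2 h' : 'M[k]_(rdegree P, rdegree M), module_hom h' & h' *m f = h.

(* P is projective and maps onto S by an essential epimorphism. *)
Definition projective_cover (P S : module) : Prop :=
  projective P /\
  exists f : 'M[k]_(rdegree P, rdegree S),
    [/\ module_hom f, row_full f &
        forall U : 'M[k]_(rdegree P), mxmodule P U -> row_full (U *m f) ->
          row_full U].

(* The largest m such that M is isomorphic to I^m + N for some N; by
   Krull-Schmidt, for I indecomposable this is the number of summands
   isomorphic to I in any decomposition of M into indecomposables.  The bound
   on m only excludes the degenerate case where I is the zero module. *)
Definition summand_mult (I M : module) : nat :=
  \max_(m < (rdegree M).+1
        | `[< exists N : module, mx_rsim M (dadd_grepr (muln_grepr I m) N) >]) m.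

Lemma trivial_mx_repr : mx_repr G (fun _ : gT => 1%:M : 'M[k]_1).
Proof. by split=> // g h _ _; rewrite mulmx1. Qed.

Definition trivial_module : module :=
  Representation (MxRepresentation trivial_mx_repr).

Definition dim_End (M : module) : nat := \rank 'C(enveloping_algebra_mx M).

(* An element of the Green ring is recorded by its coefficients on the basis
   of isomorphism classes of indecomposable modules; its values at other
   modules are meaningless.  In particular the value at P_S of a virtual
   projective module \sum_S n_S P_S is n_S. *)
Definition green_class (M : module) : module -> int :=
  fun I => (summand_mult I M)%:Z.

End Modules.

Definition restrict (k : fieldType) (gT : finGroupType) (G H : {group gT})
    (sHG : H \subset G) (M : representation k G) : representation k H :=
  Representation (subg_repr M sHG).

(* Simplicial chains: k-module on the ordered simplices (v_0, .., v_{n-1}),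
   modulo (v_{s 0}, .., v_{s (n-1)}) = sgn(s) (v_0, .., v_{n-1}).
   Everything is indexed by the number n of vertices, so that [chain n] is
   C~_{n-1}; in particular [chain 0] has the empty tuple as basis. *)
Section Chains.
Variables (k : fieldType) (gT : finGroupType) (G : {group gT}).
Variables (D : Gcomplex G) (n : nat).
Local Notation V := (gvertex D).
Local Notation to := (gact D).

Definition is_ordered_simplex : pred (n.-tuple V) :=
  fun t => uniq t && ([set v in t]%SET \in tsimplex D).
Definition ordered_simplex := {t : n.-tuple V | is_ordered_simplex t}.
Local Notation N := #|{: ordered_simplex}|.

Definition tuple_mx (f : n.-tuple V -> n.-tuple V) : 'M[k]_N :=
  \matrix_(i, j) (f (val (enum_val i)) == val (enum_val j))%:R.

Definition move_tuple (g : gT) (t : n.-tuple V) : n.-tuple V :=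
  map_tuple (to^~ g) t.

Definition perm_tuple (s : 'S_n) (t : n.-tuple V) : n.-tuple V :=
  [tuple tnth t (s i) | i < n].

Lemma tuple_mxM (f f' : n.-tuple V -> n.-tuple V) :
  (forall t, is_ordered_simplex t -> is_ordered_simplex (f t)) ->
  tuple_mx f *m tuple_mx f' = tuple_mx (f' \o f).
Proof.
move=> fS; apply/matrixP=> i l; rewrite !mxE.
pose t : ordered_simplex := Sub (f (val (enum_val i))) (fS _ (valP (enum_val i))).
rewrite (bigD1 (enum_rank t)) //= big1 ?addr0 => [|j nj].
  by rewrite !mxE enum_rankK eqxx mul1r.
rewrite !mxE; case: eqP => [e|]; last by rewrite mul0r.
by case/eqP: nj; rewrite -[j]enum_valK; congr enum_rank; apply: val_inj.
Qed.

Lemma move_tuple_simplex g t :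
  g \in G -> is_ordered_simplex t -> is_ordered_simplex (move_tuple g t).
Proof.
move=> Gg /andP[ut st]; apply/andP; split.
  by rewrite map_inj_uniq //; apply: act_inj.
have -> : [set v in move_tuple g t]%SET = (to^*)%act [set v in t]%SET g.
  apply/setP=> v; rewrite inE; apply/mapP/imsetP => -[w tw ->].
    by exists w => //; rewrite inE.
  by exists w => //; rewrite inE in tw.
move: st; rewrite !inE => /orP[/eqP-> | st]; first by rewrite /= /setact imset0 eqxx.
by rewrite (gsimplex_act Gg st) orbT.
Qed.

Lemma perm_tuple_simplex s t :
  is_ordered_simplex t -> is_ordered_simplex (perm_tuple s t).
Proof.
move=> /andP[ut st]; apply/andP; split.
  rewrite map_inj_uniq ?enum_uniq // => i j.
  by move/(tuple_uniqP _ ut)/perm_inj.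
suff -> : [set v in perm_tuple s t]%SET = [set v in t]%SET by [].
apply/setP=> v; rewrite !inE; apply/mapP/tnthP => [[i _ ->]|[i ->]].
  by exists (s i).
by exists (s^-1 i)%g; rewrite ?mem_enum ?permKV.
Qed.

Lemma ordered_chain_mx_repr : mx_repr G (fun g => tuple_mx (move_tuple g)).
Proof.
split=> [|g h Gg Gh].
  apply/matrixP=> i j; rewrite !mxE.
  have -> : move_tuple 1 (val (enum_val i)) = val (enum_val i).
    by apply: val_inj; rewrite /= -[RHS]map_id; apply: eq_map => v; rewrite act1.
  by rewrite (inj_eq val_inj) (inj_eq enum_val_inj).
rewrite tuple_mxM => [|t]; last exact: move_tuple_simplex.
congr tuple_mx; apply/funext=> t; apply: val_inj => /=.
by rewrite -map_comp; apply: eq_map => v /=; rewrite actMin.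
Qed.

Definition ordered_chain_repr := MxRepresentation ordered_chain_mx_repr.

(* The row space is spanned by all [perm_tuple s t] - sgn(s) t. *)
Definition orientation_relations : 'M[k]_N :=
  (\sum_(s : 'S_n) (tuple_mx (perm_tuple s) - ((-1) ^+ s)%:M))%MS.

Lemma orientation_relations_module :
  mxmodule ordered_chain_repr orientation_relations.
Proof.
apply/mxmoduleP=> g Gg; rewrite sumsmxMr_gen; apply/sumsmx_subP=> s _.
apply: (submx_trans _ (sumsmx_sup s _ (submx_refl _))) => //.
rewrite genmxE (_ : _ *m _ = tuple_mx (move_tuple g) *m (tuple_mx (perm_tuple s) - ((-1) ^+ s)%:M)).
  exact: submxMl.
rewrite /= mulmxBl mulmxBr scalar_mxC !tuple_mxM.
- congr (tuple_mx _ - _); apply/funext=> t.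
  by apply: eq_from_tnth => i; rewrite !(tnth_map, tnth_ord_tuple).
- by move=> t; apply: move_tuple_simplex.
- by move=> t; apply: perm_tuple_simplex.
Qed.

Definition chain : representation k G :=
  Representation (factmod_repr orientation_relations_module).

End Chains.

(* n = i + 1 vertices in degree i; C~_i = 0 for i >= #|V|. *)
Definition reduced_lefschetz (k : fieldType) (gT : finGroupType)
    (G : {group gT}) (D : Gcomplex G) : representation k G -> int :=
  fun I => \sum_(n < #|gvertex D|.+1)
    (-1) ^ ((n : nat)%:Z - 1) * green_class (chain k D n) I.

(* Main.v *)
(* For kG-modules M and N call a homomorphism M -> N projective if it is a
   relative trace \sum_g g^-1 F g of a k-linear map F.  Let pi : P -> S be a
   projective cover of a simple module.  The identity of P is a trace because P
   is a direct summand of kG, so the projective maps M -> S are exactly the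
   composites M -> P -> S; such a composite is nonzero only if M -> P is split
   surjective.  Hence the space of projective maps M -> S has dimension
   (multiplicity of P in M) * dim End(S).
   For M = k induced from a subgroup H, the space of projective maps M -> S
   is S * N with N = \sum_(h in H) h; the projective kH-maps S -> k also form a
   space of dimension rank N.  So the equality already holds orbit by orbit: by
   admissibility the stabilizer of a simplex acts trivially on its orientation,
   and the simplicial chains are a direct sum of such induced modules. *)
Require Import Defs.
From HB Require Import structures.
From mathcomp Require Import all_boot all_order all_algebra all_fingroup.
From mathcomp Require Import all_solvable all_field all_character.
From mathcomp Require Import boolp classical_sets reals topology normedtype.

Local Open Scope ring_scope.
Import GRing.Theory Num.Theory.
Set Implicit Arguments.
Unset Strict Implicit.
Unset Printing Implicit Defensive.

(** * Dimensions of spaces of linear maps and of row spaces *)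

Lemma memv_limg_linfun (k : fieldType) (U W : vectType k) (f : {linear U -> W}) w :
  reflect (exists u, w = f u) (w \in limg (linfun f)).
Proof.
apply: (iffP memv_imgP) => [[u _ ->]|[u ->]]; first by exists u; rewrite lfunE.
by exists u; rewrite ?memvf ?lfunE.
Qed.

Lemma dim_limg_inj (k : fieldType) (U W : vectType k) (f : {linear U -> W})
    (V : {vspace U}) : injective f -> \dim (linfun f @: V) = \dim V.
Proof.
move=> injf; apply: limg_dim_eq; suff /eqP-> : lker (linfun f) == 0%VS by rewrite capv0.
by apply/lker0P=> u v; rewrite !lfunE; apply: injf.
Qed.

(** The image of [V] under [f] is the row space of [A], which is also the injective image of the row
    vectors of length [\rank A] under the free matrix [row_base A]. *)
Lemma dimv_rank (k : fieldType) (W : vectType k) (V : {vspace W}) m n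
    (f : {linear W -> 'rV[k]_n}) (A : 'M[k]_(m, n)) :
    injective f -> (forall v, v \in V -> (f v <= A)%MS) ->
    (forall u : 'rV_n, (u <= A)%MS -> exists2 v, v \in V & f v = u) ->
  \dim V = \rank A.
Proof.
move=> injf fV fVA; pose h := mulmxr (row_base A) : 'rV_(\rank A) -> _.
have injh : injective h by apply: row_free_inj; apply: row_base_free.
rewrite -(dim_limg_inj V injf).
have dimA : \dim (limg (linfun h)) = \rank A.
  by rewrite dim_limg_inj // dimvf /dim /= mul1n.
rewrite -[RHS]dimA; congr (\dim _); apply/vspaceP=> u; apply/memv_imgP/memv_limg_linfun.
  case=> v Vv ->; rewrite lfunE /=; have := fV v Vv.
  by rewrite -(eq_row_base A) => /submxP.
case=> w /= uE; have [|v Vv fv] := fVA u; last by exists v; rewrite ?lfunE.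
by rewrite uE -(eq_row_base A) submxMl.
Qed.

Lemma row_free_ker0 (k : fieldType) m n (A : 'M[k]_(m, n)) :
  (forall v : 'rV_m, v *m A = 0 -> v = 0) -> row_free A.
Proof.
move=> kerA; rewrite -kermx_eq0; apply/eqP/row_matrixP=> i; rewrite row0.
exact/kerA/sub_kermxP/row_sub.
Qed.

(** * Relative traces and multiplicities of projective covers *)

Section Trace.
Variables (k : fieldType) (gT : finGroupType) (G : {group gT}).
Local Notation module := (representation k G).

Lemma module_homM (M N Q : module) (f : 'M_(rdegree M, rdegree N))
    (h : 'M_(rdegree N, rdegree Q)) :
  module_hom f -> module_hom h -> module_hom (f *m h).
Proof. by move=> homf homh g Gg; rewrite mulmxA homf // -!mulmxA homh. Qed.

Definition trace_hom (M N : module) (F : 'M[k]_(rdegree M, rdegree N)) :=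
  \sum_(g in G) M g^-1%g *m F *m N g.

Fact trace_hom_is_linear M N : linear (@trace_hom M N).
Proof.
move=> a F F'; rewrite scaler_sumr -big_split; apply: eq_bigr => g _ /=.
by rewrite mulmxDr mulmxDl -scalemxAr -scalemxAl.
Qed.
HB.instance Definition _ M N := GRing.isSemilinear.Build k _ _ _ (@trace_hom M N)
  (GRing.semilinear_linear (@trace_hom_is_linear M N)).

(** Right translation by [x] permutes the summands of the trace. *)
Lemma trace_hom_module_hom M N (F : 'M_(rdegree M, rdegree N)) :
  module_hom (trace_hom F).
Proof.
move=> x Gx; rewrite mulmx_suml mulmx_sumr.
rewrite (reindex_acts 'R _ Gx) ?astabsR //=; apply: eq_bigr => g Gg.
rewrite -mulmxA -!mulmxA -repr_mxM // !mulmxA -repr_mxM ?groupV ?groupM //.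
by rewrite invMg mulKVg.
Qed.

Lemma trace_hom_mull (M N Q : module) (f : 'M_(rdegree M, rdegree N))
    (F : 'M_(rdegree N, rdegree Q)) :
  module_hom f -> trace_hom (f *m F) = f *m trace_hom F.
Proof.
move=> homf; rewrite mulmx_sumr; apply: eq_bigr => g Gg.
by rewrite !mulmxA homf ?groupV.
Qed.

Lemma trace_hom_mulr (M N Q : module) (F : 'M_(rdegree M, rdegree N))
    (f : 'M_(rdegree N, rdegree Q)) :
  module_hom f -> trace_hom (F *m f) = trace_hom F *m f.
Proof.
move=> homf; rewrite mulmx_suml; apply: eq_bigr => g Gg.
by rewrite -!mulmxA homf.
Qed.

Definition regular_module : module := Representation (regular_repr k G).

(** For [F] take the projection of kG onto the line of 1. Its conjugate by g is the projection onto
    the line of g, and these projections add up to the identity. *)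
Lemma trace_hom_regular : exists F, trace_hom F = 1%:M :> 'M_(rdegree regular_module).
Proof.
pose i1 := gring_index G 1%g; exists (delta_mx i1 i1).
have row_aG i g : g \in G -> delta_mx 0 i *m regular_mx k G g
   = delta_mx 0 (gring_index G (enum_val i * g)%g) :> 'rV[k]_#|G|.
  by move=> Gg; rewrite -rowE rowK.
apply/row_matrixP=> i; rewrite linear_sum /= (bigD1 (enum_val i)) ?enum_valP //=.
rewrite !rowE !mulmxA row_aG ?groupV ?enum_valP // mulgV mul_delta_mx.
rewrite row_aG ?enum_valP // gring_indexK // mul1g gring_valK.
rewrite big1 ?addr0 ?mulmx1 // => g /andP[Gg neqg].
rewrite rowE !mulmxA row_aG ?groupV // mul_delta_mx_cond.
case: eqP => [/(congr1 enum_val)|]; last by rewrite mulr0n mul0mx.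
rewrite !gring_indexK ?groupM ?groupV ?enum_valP // => /eqP.
by rewrite -eq_mulgV1 eq_sym (negPf neqg).
Qed.

(** This is the homomorphism from kG to [M] that sends the basis vector of 1 to [u]. *)
Definition orbit_mx (M : module) (u : 'rV_(rdegree M)) : 'M[k]_(#|G|, rdegree M) :=
  \matrix_i (u *m M (enum_val i)).

Lemma orbit_mx_module_hom (M : module) (u : 'rV_(rdegree M)) :
  @module_hom _ _ _ regular_module M (orbit_mx u).
Proof.
move=> g Gg; apply/row_matrixP=> i; rewrite !row_mul !rowK -rowE rowK.
by rewrite gring_indexK ?groupM ?enum_valP // -mulmxA repr_mxM ?enum_valP.
Qed.

Lemma mem_orbit_mx (M : module) (u : 'rV_(rdegree M)) : (u <= orbit_mx u)%MS.
Proof.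
have uE : row (gring_index G 1%g) (orbit_mx u) = u.
  by rewrite rowK gring_indexK // repr_mx1 mulmx1.
by rewrite -[X in (X <= _)%MS]uE row_sub.
Qed.

Lemma module_hom_im (M N : module) (f : 'M_(rdegree M, rdegree N)) :
  module_hom f -> mxmodule N <<f>>%MS.
Proof.
by move=> homf; apply/mxmoduleP=> g Gg; rewrite (eqmxMr _ (genmxE f)) genmxE -homf ?submxMl.
Qed.

Lemma module_hom_ker (M N : module) (f : 'M_(rdegree M, rdegree N)) :
  module_hom f -> mxmodule M (kermx f).
Proof.
move=> homf; apply/mxmoduleP=> g Gg; apply/sub_kermxP.
by rewrite -mulmxA homf // mulmxA mulmx_ker mul0mx.
Qed.

Lemma irreducible_module_hom (M S : module) (f : 'M_(rdegree M, rdegree S)) :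
  mx_irreducible S -> module_hom f -> f != 0 -> row_full f.
Proof.
move=> /mx_irrP[_ irrS] /module_hom_im/irrS; rewrite -!mxrank_eq0 -!col_leq_rank genmxE.
exact.
Qed.

Definition trace_homs (M N : module) := limg (linfun (@trace_hom M N)).

(** * Projective maps to a simple module and its projective cover *)

Section Cover.
Variables (P S : module) (irrS : mx_irreducible S) (pi : 'M[k]_(rdegree P, rdegree S)).
Hypotheses (projP : projective P) (hompi : module_hom pi) (fullpi : row_full pi).
Hypothesis esspi :
  forall U : 'M_(rdegree P), mxmodule P U -> row_full (U *m pi) -> row_full U.

(** Simplicity of [S] makes the composite with [pi] onto, and essentiality of [pi] then makes [f]
    onto. *)
Lemma cover_irr_neq0 (M : module) (f : 'M_(rdegree M, rdegree P)) :
  module_hom f -> f *m pi != 0 -> row_full f.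
Proof.
move=> homf nzf; have := esspi (module_hom_im homf).
rewrite -!col_leq_rank (eqmxMr _ (genmxE f)) genmxE !col_leq_rank; apply.
exact: irreducible_module_hom irrS (module_homM homf hompi) nzf.
Qed.

(** The map from kG to [P] given by a vector outside the kernel of [pi] is onto, hence split by
    projectivity. Through this splitting, the trace expression of the identity of kG yields one for
    [P]. *)
Lemma trace_hom_cover_id : exists F, trace_hom F = 1%:M :> 'M_(rdegree P).
Proof.
have [F0 trF0] := trace_hom_regular.
have pi_neq0 : pi != 0.
  rewrite -mxrank_eq0 (eqP fullpi) -lt0n.
  by case/mx_irrP: irrS.
have [i nzi] : exists i, row i pi != 0.
  apply/existsP; apply: contraNT pi_neq0; rewrite negb_exists => /forallP pi0.
  by apply/eqP/row_matrixP=> i; rewrite row0; apply/eqP; rewrite -[_ == _]negbK.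
pose u : 'rV[k]_(rdegree P) := delta_mx 0 i.
have homu := orbit_mx_module_hom u.
have fullu : row_full (orbit_mx u).
  apply: cover_irr_neq0 homu _; apply: contraNneq nzi => u0.
  by have := submxMr pi (mem_orbit_mx u); rewrite u0 -rowE => /submx0null->.
have homid : module_hom (1%:M : 'M_(rdegree P)) by move=> g _; rewrite mulmx1 mul1mx.
have [s homs sK] := projP homu fullu homid.
exists (s *m (F0 *m orbit_mx u)).
by rewrite trace_hom_mull // (trace_hom_mulr _ homu) trF0 mul1mx.
Qed.

Lemma trace_homsP (M : module) (F : 'M_(rdegree M, rdegree S)) :
  reflect (exists2 f : 'M_(rdegree M, rdegree P), module_hom f & F = f *m pi)
          (F \in trace_homs M S).
Proof.
apply: (iffP (memv_limg_linfun _ _)) => [[F0 ->] | [f homf ->]].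
  (* [pinvmx pi] is only a k-linear section of [pi]; taking the trace makes the lift equivariant. *)
  exists (trace_hom (F0 *m pinvmx pi)); first exact: trace_hom_module_hom.
  by rewrite -trace_hom_mulr // mulmxKpV // submx_full.
have [F1 trF1] := trace_hom_cover_id; exists (f *m (F1 *m pi)).
by rewrite /= trace_hom_mull // trace_hom_mulr // trF1 mul1mx.
Qed.

(** [F] kills the kernel of [pi], so it factors through [pi], and any k-linear section of [pi]
    computes the induced map on [S]. *)
Lemma cover_factor (F : 'M_(rdegree P, rdegree S)) :
  module_hom F -> pi *m (pinvmx pi *m F) = F.
Proof.
move=> homF; apply/eqP; rewrite -subr_eq0 mulmxA -{2}[F]mul1mx -mulmxBl.
(* The rows of [pi *m pinvmx pi - 1%:M] lie in the kernel of [pi], so it remains to place that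
   kernel inside the kernel of [F]. *)
apply/eqP/sub_kermxP; apply: (@submx_trans _ _ _ _ _ _ (kermx pi)).
  by apply/sub_kermxP; rewrite mulmxBl mul1mx mulmxKpV ?subrr // submx_full.
have [-> | nzF] := eqVneq F 0; first by apply/sub_kermxP; rewrite mulmx0.
have fullF := irreducible_module_hom irrS homF nzF.
(* The reverse inclusion is enough: [F] and [pi] are both onto [S], so their kernels have the same
   dimension. *)
suff skF : (kermx F <= kermx pi)%MS.
  suff /eqmxP-> : (kermx F == kermx pi)%MS by [].
  rewrite -(geq_leqif (mxrank_leqif_eq skF)).
  by rewrite !mxrank_ker (eqP fullF) (eqP fullpi).
(* If [pi] did not kill the kernel of [F], it would map it onto the simple module [S]; by
   essentiality the kernel would be all of [P]. *)
apply/sub_kermxP; apply: contraTeq nzF => nzk; rewrite negbK.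
have homk : mxmodule S <<kermx F *m pi>>%MS.
  rewrite (eqmx_module _ (genmxE _)); apply/mxmoduleP=> g Gg.
  rewrite -mulmxA -hompi // mulmxA submxMr //.
  exact: (mxmoduleP (module_hom_ker homF)).
have fullk : row_full (kermx F *m pi).
  have [_ /(_ _ homk)] := (mx_irrP _).1 irrS.
  by rewrite -!mxrank_eq0 -!col_leq_rank genmxE mxrank_eq0; apply.
have := esspi (module_hom_ker homF) fullk; rewrite -sub1mx => /sub_kermxP.
by rewrite mul1mx => ->.
Qed.

(** Every homomorphism from [P] to [S] is projective, because the identity of [P] is a trace, and is
    [pi] followed by a unique endomorphism of [S]. *)
Lemma dim_trace_homs_cover : \dim (trace_homs P S) = dim_End S.
Proof.
pose h := mulmx pi : 'M_(rdegree S) -> _.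
have injh : injective h.
  move=> e e' ee'; have [pi' piK] := row_fullP fullpi.
  by rewrite -[e]mul1mx -[e']mul1mx -piK -!mulmxA; congr (_ *m _).
have defV : (linfun h @: (linfun h @^-1: trace_homs P S))%VS = trace_homs P S.
  apply: lpreimK; apply/subvP=> F /trace_homsP[f homf ->]; apply/memv_limg_linfun.
  by exists (pinvmx pi *m (f *m pi)); rewrite /= /h cover_factor //; apply: module_homM.
rewrite -defV dim_limg_inj //; apply: (@dimv_rank _ _ _ _ _ mxvec).
- exact: (can_inj mxvecK).
- move=> e; rewrite -memv_preim lfunE /= => /trace_homsP[f homf hE].
  have home g : g \in G -> S g *m e = e *m S g.
    move=> Gg; apply: injh; have {}hE : pi *m e = f *m pi := hE.
    by rewrite /h mulmxA -hompi // -mulmxA [RHS]mulmxA hE (module_homM homf hompi).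
  apply/cent_mxP=> A /envelop_mxP[a ->]; rewrite mulmx_suml mulmx_sumr.
  by apply: eq_bigr => g Gg; rewrite -scalemxAl -scalemxAr home.
move=> v vC; exists (vec_mx v); last exact: vec_mxK.
rewrite -memv_preim lfunE /=.
have /cent_mxP cE : (vec_mx v \in 'C(enveloping_algebra_mx S))%MS by rewrite vec_mxK.
have home : module_hom (vec_mx v : 'M_(rdegree S)).
  by move=> g Gg; rewrite cE // envelop_mx_id.
have [F1 trF1] := trace_hom_cover_id; apply/memv_limg_linfun.
exists (F1 *m h (vec_mx v)).
by rewrite /= trace_hom_mulr ?trF1 ?mul1mx //; apply: module_homM.
Qed.

(** A nonzero projective map factors as [f *m pi] with [f] onto [P]. Projectivity of [P] splits [f],
    and [N'] is the kernel of [f]. *)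
Lemma split_cover (N : module) : trace_homs N S != 0%VS ->
  exists N' : module, mx_rsim N (dadd_grepr P N').
Proof.
move=> nzV.
have [F /trace_homsP[f homf ->] nzF] : exists2 F, F \in trace_homs N S & F != 0.
  by exists (vpick (trace_homs N S)); rewrite ?memv_pick ?vpick0.
have fullf := cover_irr_neq0 homf nzF.
have homid : module_hom (1%:M : 'M_(rdegree P)) by move=> g _; rewrite mulmx1 mul1mx.
have [s homs sK] := projP homf fullf homid.
pose modK := module_hom_ker homf; exists (Representation (submod_repr modK)).
(* The isomorphism from the sum of [P] and the kernel of [f] to [N]: the section [s] on the first
   summand, the inclusion on the second. *)
apply: mx_rsim_sym; exists (col_mx s (val_submod 1%:M)) => /=.
- by rewrite mxrank_ker (eqP fullf) subnKC // -(eqP fullf) rank_leq_row.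
- apply: row_free_ker0 => v.
  set w := val_submod _; have wf : w *m f = 0 by apply/sub_kermxP; rewrite val_submod1.
  have wE u : u *m w = 0 -> u = 0.
    by rewrite -val_submodE => /eqP; rewrite val_submod_eq0 => /eqP.
  clearbody w.
  rewrite -[v](@hsubmxK _ _ (rdegree P) (\rank (kermx f))) mul_row_col => v0.
  (* Applying [f] kills the kernel part and returns the first coordinate, as [s *m f = 1%:M]. *)
  have l0 : lsubmx v = 0.
    by move/(congr1 (mulmx^~ f)): v0; rewrite mulmxDl -!mulmxA wf sK mulmx1 mulmx0 addr0 mul0mx.
  by move: v0; rewrite l0 mul0mx add0r => /wE->; rewrite row_mx0.
move=> g Gg; rewrite mul_block_col !mul0mx addr0 add0r mul_col_mx homs //.
by rewrite -val_submodE -[submod_mx modK g]mul1mx val_submodJ.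
Qed.

End Cover.

(** * Additivity of trace spaces and the multiplicity formula *)

Lemma mulmx_injl m n r (A : 'M[k]_(m, n)) :
  row_full A -> injective (mulmx A : 'M_(n, r) -> 'M_(m, r)).
Proof.
by case/row_fullP=> A' AK; apply: (can_inj (g := mulmx A')) => F; rewrite mulmxA AK mul1mx.
Qed.

(** Precomposition with the two projections [p1] and [p2] embeds both trace spaces in that of the
    sum, as complementary subspaces. *)
Lemma trace_homs_dadd (M N S : module) :
  \dim (trace_homs (dadd_grepr M N) S) = (\dim (trace_homs M S) + \dim (trace_homs N S))%N.
Proof.
pose p1 : 'M[k]_(rdegree (dadd_grepr M N), rdegree M) := col_mx 1%:M 0.
pose p2 : 'M[k]_(rdegree (dadd_grepr M N), rdegree N) := col_mx 0 1%:M.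
have hom1 : module_hom p1.
  by move=> g _; rewrite mul_block_col mul_col_mx !mulmx0 !mulmx1 mul0mx mul1mx !addr0.
have hom2 : module_hom p2.
  by move=> g _; rewrite mul_block_col mul_col_mx !mulmx0 !mulmx1 mul0mx mul1mx !add0r.
have full1 : row_full p1.
  by apply/row_fullP; exists (row_mx 1%:M 0); rewrite mul_row_col mulmx1 mulmx0 addr0.
have full2 : row_full p2.
  by apply/row_fullP; exists (row_mx 0 1%:M); rewrite mul_row_col mulmx1 mulmx0 add0r.
rewrite -(dim_limg_inj _ (@mulmx_injl _ _ _ _ full1)) -(dim_limg_inj _ (@mulmx_injl _ _ _ _ full2)).
rewrite -dimv_disjoint_sum; last first.
  apply/eqP; rewrite -subv0; apply/subvP=> F; rewrite memv_cap.
  case/andP=> /memv_imgP[F1 _ ->] /memv_imgP[F2 _]; rewrite !lfunE /= !mul_col_mx !mul1mx !mul0mx.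
  by case/eq_col_mx=> -> _; rewrite memv0 col_mx0.
congr (\dim _); apply/vspaceP=> F; apply/memv_limg_linfun/memv_addP.
  case=> F0 ->; pose F1 : 'M[k]_(rdegree M, _) := @usubmx _ (rdegree M) (rdegree N) _ F0.
  pose F2 : 'M[k]_(rdegree N, _) := @dsubmx _ (rdegree M) (rdegree N) _ F0.
  exists (p1 *m trace_hom F1).
    apply/memv_imgP; exists (trace_hom F1); last by rewrite lfunE.
    by apply/memv_limg_linfun; exists F1.
  exists (p2 *m trace_hom F2).
    apply/memv_imgP; exists (trace_hom F2); last by rewrite lfunE.
    by apply/memv_limg_linfun; exists F2.
  rewrite -(trace_hom_mull _ hom1) -(trace_hom_mull _ hom2) -[RHS]linearD /=.
  by rewrite !mul_col_mx !mul1mx !mul0mx add_col_mx add0r addr0 vsubmxK.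
case=> _ /memv_imgP[_ /memv_limg_linfun[F1 ->] ->].
case=> _ /memv_imgP[_ /memv_limg_linfun[F2 ->] ->] ->.
exists (p1 *m F1 + p2 *m F2); rewrite linearD /= !lfunE /=.
by rewrite -(trace_hom_mull _ hom1) -(trace_hom_mull _ hom2).
Qed.

Lemma trace_homs_rsim (M M' S : module) :
  mx_rsim M M' -> \dim (trace_homs M S) = \dim (trace_homs M' S).
Proof.
suff le (N N' : module) : mx_rsim N N' -> (\dim (trace_homs N' S) <= \dim (trace_homs N S))%N.
  by move=> simM; apply/eqP; rewrite eqn_leq !le //; apply: mx_rsim_sym.
case=> B eqN freeB homB; have fullB : row_full B by rewrite /row_full (eqP freeB) eqN.
rewrite -(dim_limg_inj _ (@mulmx_injl _ _ _ _ fullB)); apply/dimvS/subvP=> _ /memv_imgP[_ /memv_limg_linfun[F ->] ->].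
rewrite lfunE /=; apply/memv_limg_linfun; exists (B *m F).
by rewrite /= trace_hom_mull.
Qed.

(* [muln_grepr P m.+1] adds the new copy of P on the left, so the blocks of the
   two decompositions have to be permuted. *)
Lemma mx_rsim_muln_grepr1 (P M N N' : module) m :
    mx_rsim M (dadd_grepr (muln_grepr P m) N) -> mx_rsim N (dadd_grepr P N') ->
  mx_rsim M (dadd_grepr (muln_grepr P m.+1) N').
Proof.
move=> simM simN; apply: (mx_rsim_trans simM); apply: mx_rsim_sym.
case/mx_rsim_sym: simN => B eqN freeB homB.
rewrite [muln_grepr P m.+1]/muln_grepr big_ord_recl -/(muln_grepr P m).
move: (muln_grepr P m) => Q.
pose B1 : 'M[k]_(rdegree P, _) := @usubmx _ (rdegree P) (rdegree N') _ B.
pose B2 : 'M[k]_(rdegree N', _) := @dsubmx _ (rdegree P) (rdegree N') _ B.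
have BE : B = col_mx B1 B2 by rewrite vsubmxK.
have homB12 g : g \in G -> P g *m B1 = B1 *m N g /\ N' g *m B2 = B2 *m N g.
  move=> /homB; rewrite BE mul_block_col !mul0mx addr0 add0r mul_col_mx => /eq_col_mx[].
  by [].
(* Block rows are [P], [Q], [N'] and block columns are [Q], [N]: the isomorphism [B] sends [P] and
   [N'] into [N], while [Q] goes to itself. *)
exists (col_mx (col_mx (row_mx 0 B1) (row_mx 1%:M 0)) (row_mx 0 B2)) => /=.
- by rewrite -eqN /= [(rdegree P + _)%N]addnC -addnA.
- apply: row_free_ker0 => v; rewrite -[v](@hsubmxK _ _ (rdegree P + rdegree Q) (rdegree N')).
  move: (lsubmx v) (rsubmx v) => ab c; rewrite -[ab](@hsubmxK _ _ (rdegree P) (rdegree Q)).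
  move: (lsubmx ab) (rsubmx ab) => a b {v ab}.
  rewrite !mul_row_col !mul_mx_row !mulmx0 mulmx1 !add_row_mx !addr0 add0r.
  rewrite -[X in row_mx _ X]mul_row_col -BE -[0]row_mx0 => /eq_row_mx[-> abB].
  have : row_mx a c = 0 by apply: (row_free_inj freeB); rewrite mul0mx.
  by rewrite -[0]row_mx0 => /eq_row_mx[-> ->]; rewrite !row_mx0.
move=> g Gg; have [h1 h2] := homB12 g Gg.
rewrite mul_block_col !mul0mx addr0 add0r mul_block_col !mul0mx addr0 add0r.
rewrite !mul_mx_row !mul_col_mx !mul_row_block !mulmx0 !mul0mx !mul1mx !mulmx1 !(addr0, add0r).
by rewrite h1 h2.
Qed.

(** Split off the largest possible number of copies of [P]. Each contributes [dim_End S], and the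
    remainder contributes nothing, since a nonzero projective map from it to [S] would split off one
    more copy. *)
Lemma mult_cover_dim_End (P S M : module) : mx_irreducible S -> projective_cover P S ->
  (summand_mult P M * dim_End S)%N = \dim (trace_homs M S).
Proof.
move=> irrS [projP [pi [hompi fullpi esspi]]].
have dimP := dim_trace_homs_cover irrS projP hompi fullpi esspi.
have split := split_cover irrS projP hompi fullpi esspi.
have degP : (0 < rdegree P)%N.
  apply: leq_trans (rank_leq_row pi); rewrite (eqP fullpi).
  by have [] := (mx_irrP _).1 irrS.
have dim_muln m : \dim (trace_homs (muln_grepr P m) S) = (m * dim_End S)%N.
  elim: m => [|m IH].
    apply/eqP; rewrite -leqn0 (leq_trans (dimvS (subvf _))) // dimvf /dim /=.
    by rewrite /muln_grepr big_ord0.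
  rewrite /muln_grepr big_ord_recl -/(muln_grepr P m) trace_homs_dadd IH dimP.
  by rewrite mulSn.
have deg_muln m : rdegree (muln_grepr P m) = (m * rdegree P)%N.
  elim: m => [|m IH]; first by rewrite /muln_grepr big_ord0.
  by rewrite /muln_grepr big_ord_recl -/(muln_grepr P m) /= IH mulSn.
pose A m := `[< exists N : module, mx_rsim M (dadd_grepr (muln_grepr P m) N) >].
have A0 : A 0%N.
  apply/asboolP; exists M; rewrite /muln_grepr big_ord0.
  exists (row_mx (0 : 'M_(_, 0)) 1%:M) => //=.
    by apply/row_freeP; exists (col_mx 0 1%:M); rewrite mul_row_col mul0mx mulmx1 add0r.
  move=> g _; rewrite mul_mx_row mul_row_block; congr (row_mx _ _).
    by rewrite [LHS]thinmx0 [RHS]thinmx0.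
  by rewrite mulmx0 add0r mulmx1 mul1mx.
(* As [P] is nonzero, the bound on m in [summand_mult] excludes no decomposition. *)
have A_lt m : A m -> (m < (rdegree M).+1)%N.
  move=> /asboolP[N /mxrank_rsim ->]; rewrite ltnS /= deg_muln.
  by rewrite (leq_trans _ (leq_addr _ _)) // leq_pmulr.
have A0' : (0 < #|[pred m : 'I_(rdegree M).+1 | A m]|)%N.
  by apply/card_gt0P; exists ord0; exact: A0.
have [m Am mE] := eq_bigmax_cond (fun m : 'I_(rdegree M).+1 => nat_of_ord m) A0'.
have -> : summand_mult P M = m by rewrite -mE.
have /asboolP[N simN] := Am.
rewrite (trace_homs_rsim S simN) trace_homs_dadd dim_muln.
suff -> : trace_homs N S = 0%VS by rewrite dimv0 addn0.
apply/eqP; apply: contraT => /split[N' simN'].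
have Am1 : A m.+1 by apply/asboolP; exists N'; apply: mx_rsim_muln_grepr1 simN simN'.
have Am1' : Ordinal (A_lt _ Am1) \in [pred m : 'I_(rdegree M).+1 | A m] by [].
have := leq_bigmax_cond (F := fun m : 'I_(rdegree M).+1 => nat_of_ord m) _ Am1'.
by rewrite mE ltnn.
Qed.

End Trace.

(** * Norm elements and the trivial module *)

Definition norm_mx (k : fieldType) (gT : finGroupType) (G : {group gT}) n
  (rG : mx_representation k G n) (H : {set gT}) : 'M[k]_n := \sum_(h in H) rG h.

(** The identity is a nonzero endomorphism. *)
Lemma dim_End_gt0 (k : fieldType) (gT : finGroupType) (G : {group gT})
    (S : representation k G) : mx_irreducible S -> (0 < dim_End S)%N.
Proof.
case/mx_irrP=> S_gt0 _; rewrite lt0n mxrank_eq0; apply/eqP=> C0.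
have := scalar_mx_cent 1 (enveloping_algebra_mx S).
rewrite C0 => /submx0null/eqP; rewrite mxvec_eq0 => /eqP/matrixP.
by move/(_ (Ordinal S_gt0) (Ordinal S_gt0))/eqP; rewrite !mxE eqxx oner_eq0.
Qed.

Section Trivial.
Variables (k : fieldType) (gT : finGroupType) (H : {group gT}).

Lemma trivial_module_irr : mx_irreducible (trivial_module k H).
Proof.
apply/mx_irrP; split=> // U _ nzU.
by rewrite -col_leq_rank lt0n mxrank_eq0.
Qed.

Lemma dim_End_trivial : dim_End (trivial_module k H) = 1%N.
Proof.
apply/eqP; rewrite eqn_leq (leq_trans (rank_leq_row _)) //=.
exact: dim_End_gt0 trivial_module_irr.
Qed.

(** Since [H] acts on the target by 1, the trace of [F] is [norm_mx S H *m F]. The traces thus form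
    the column space of the norm, whence the transpose. *)
Lemma dim_trace_homs_trivial (S : representation k H) :
  \dim (trace_homs S (trivial_module k H)) = \rank (norm_mx S H).
Proof.
have trE (F : 'M[k]_(rdegree S, rdegree (trivial_module k H))) :
    trace_hom F = norm_mx S H *m F.
  rewrite mulmx_suml (reindex_inj invg_inj) /=.
  by apply: eq_big => [h|h _]; rewrite ?groupV // mulmx1.
rewrite -mxrank_tr; apply: (@dimv_rank _ _ _ _ _ (@trmx k (rdegree S) 1)); first exact: trmx_inj.
  by move=> _ /memv_limg_linfun[F ->] /=; rewrite trE trmx_mul submxMl.
move=> u /submxP[w uE]; exists u^T; last exact: trmxK.
apply/memv_limg_linfun; exists w^T.
by rewrite /= trE uE trmx_mul trmxK.
Qed.
End Trivial.

(** The part of the sum over a left coset of x is [a x *m S x *m norm_mx S H]. *)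
Lemma sum_coset_submx (k : fieldType) (gT : finGroupType) (G H : {group gT}) r
    (S : mx_representation k G r) m (a : gT -> 'M_(m, r)) :
    H \subset G -> (forall g h, g \in G -> h \in H -> a (g * h)%g = a g) ->
  ((\sum_(g in G) a g *m S g)%R <= norm_mx S H)%MS.
Proof.
move=> sHG aH; rewrite (partition_big (fun g => g *: H)%g [in lcosets H G]) /=; last first.
  by move=> g Gg; apply/lcosetsP; exists g.
apply: summx_sub => _ /lcosetsP[x Gx ->].
rewrite (reindex_inj (mulgI x)) (eq_bigl [in H]) => [|h]; last first.
  rewrite groupMl //; apply/andP/idP => [[Gh /eqP]| Hh].
    by move/lcoset_eqP; rewrite mem_lcoset mulKg.
  by rewrite (fintype.subsetP sHG) //; split=> //; apply/eqP/lcoset_eqP; rewrite mem_lcoset mulKg.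
rewrite (_ : \sum_(h in H) _ = (a x *m S x) *m norm_mx S H) ?submxMl //.
rewrite mulmx_sumr; apply: eq_bigr => h Hh.
by rewrite aH // repr_mxM ?mulmxA // (fintype.subsetP sHG).
Qed.

(** The space is the direct sum of the row spaces of the [B i], each placed in its own row. *)
Lemma dim_row_submx (k : fieldType) m r (V : {vspace 'M[k]_(m, r)}) (B : 'I_m -> 'M[k]_r) :
    (forall A, A \in V <-> forall i, (row i A <= B i)%MS) ->
  \dim V = (\sum_i \rank (B i))%N.
Proof.
move=> VB; pose h i := mulmx (delta_mx i 0 : 'cV_m) : 'rV[k]_r -> 'M_(m, r).
have rowh i j v : row j (h i v) = (i == j)%:R *: v.
  apply/rowP=> l; rewrite /h !mxE big_ord1 !mxE eqxx andbT eq_sym.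
  by [].
have defV : V = (\sum_i (linfun (h i) @: limg (linfun (mulmxr (B i)))))%VS.
  apply/vspaceP=> A; apply/idP/memv_sumP => [/VB AB | [vs vsP ->]].
    exists (fun i => h i (row i A)) => [i _|].
      have /submxP[w ->] := AB i; apply/memv_imgP; exists (w *m B i); last by rewrite lfunE.
      by apply/memv_limg_linfun; exists w.
    apply/row_matrixP=> j; rewrite linear_sum (bigD1 j) //= rowh eqxx scale1r.
    by rewrite big1 ?addr0 // => i ij; rewrite rowh (negPf ij) scale0r.
  apply/VB=> j; rewrite linear_sum (bigD1 j) //= big1 => [|i ij].
    have /memv_imgP[_ /memv_limg_linfun[w ->] ->] := vsP j isT.
    by rewrite lfunE /= rowh eqxx scale1r addr0 submxMl.
  have /memv_imgP[w _ ->] := vsP i isT.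
  by rewrite lfunE /= rowh (negPf ij) scale0r.
have dxV : directv (\sum_i (linfun (h i) @: limg (linfun (mulmxr (B i))))).
  apply/directv_sum_independent => vs vsP vs0 j _.
  have /memv_imgP[w _ vsj] := vsP j isT; rewrite vsj lfunE /=.
  suff -> : w = 0 by rewrite /h mulmx0.
  have := congr1 (row j) vs0; rewrite linear_sum (bigD1 j) //= vsj lfunE /= rowh eqxx scale1r row0.
  rewrite big1 ?addr0 // => i ij; have /memv_imgP[u _ ->] := vsP i isT.
  by rewrite lfunE /= rowh (negPf ij) scale0r.
rewrite defV (directvP dxV) /=; apply: eq_bigr => i _.
rewrite dim_limg_inj; last first.
  by move=> u v /(congr1 (row i)); rewrite !rowh eqxx !scale1r.
apply: (@dimv_rank _ _ _ _ _ idfun) => //.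
  by move=> _ /memv_limg_linfun[w ->]; rewrite submxMl.
by move=> u /submxP[w ->]; exists (w *m B i) => //; apply/memv_limg_linfun; exists w.
Qed.

(** * Simplicial chains *)

Section OrbitReps.
Variables (gT : finGroupType) (G : {group gT}) (D : Gcomplex G).
Local Notation V := (gvertex D).
Local Notation to := (Defs.gact D).
Variables (X : {set {set V}}) (repsX : orbit_reps X).

Lemma orbit_reps_simplex s : s \in X -> s \in tsimplex D.
Proof. by have /and3P[_ /fintype.subsetP sX _] := repsX; apply: sX. Qed.

Lemma orbit_reps_orbit s : s \in tsimplex D ->
  exists2 t, t \in X & exists2 g, g \in G & (to^*)%act t g = s.
Proof.
move=> Ds; have /and3P[_ _ /forall_inP/(_ (orbit (to^*)%act G s) (imset_f _ Ds))] := repsX.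
move=> /cards1P[t tE]; have : t \in X :&: orbit (to^*)%act G s by rewrite tE set11.
rewrite inE orbit_in_sym // => /andP[Xt /orbitP[g Gg tg]].
by exists t => //; exists g.
Qed.

Lemma orbit_reps_uniq s t g :
  s \in X -> t \in X -> g \in G -> (to^*)%act s g = t -> s = t.
Proof.
move=> Xs Xt Gg st; have Ds := orbit_reps_simplex Xs.
have /and3P[_ _ /forall_inP/(_ (orbit (to^*)%act G s) (imset_f _ Ds))] := repsX.
move=> /cards1P[u uE].
have : s \in X :&: orbit (to^*)%act G s by rewrite inE Xs orbit_refl.
have : t \in X :&: orbit (to^*)%act G s by rewrite inE Xt -st mem_orbit.
by rewrite uE !inE => /eqP-> /eqP->.
Qed.

(** This is admissibility, extended to the empty simplex, which has no vertex to fix. *)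
Lemma simplex_stab_fix s h v :
  s \in tsimplex D -> h \in simplex_stab s -> v \in s -> to v h = v.
Proof.
move=> Ds; rewrite inE => /andP[Gh /astabs_setact sh] sv.
move: Ds; rewrite !inE => /orP[/eqP s0 | Ds]; first by rewrite s0 inE in sv.
exact: gsimplex_admissible sv.
Qed.

Lemma mem_simplex_stab s h : h \in G -> (to^*)%act s h = s -> h \in simplex_stab s.
Proof.
move=> Gh sh; rewrite !inE Gh /=; apply/fintype.subsetP=> v sv.
by rewrite inE; have : to v h \in (to^*)%act s h by [apply: imset_f]; rewrite sh.
Qed.

End OrbitReps.

(** * Simplicial chains as a quotient of ordered chains *)

Section Chains.
Variables (k : fieldType) (gT : finGroupType) (G : {group gT}) (D : Gcomplex G) (n : nat).
Local Notation V := (gvertex D).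
Local Notation to := (Defs.gact D).
Local Notation N := #|{: ordered_simplex D n}|.
Local Notation OC := (Representation (ordered_chain_repr k D n)).
Local Notation pmx s := (tuple_mx k (@perm_tuple gT G D n s)).

(** The basis vector of [t]. It is zero if [t] is not an ordered simplex, so no membership proof has
    to be carried along. *)
Definition tuple_row (t : n.-tuple V) : 'rV[k]_N := \row_j (t == val (enum_val j))%:R.

Lemma tuple_row_delta (t : n.-tuple V) (Dt : is_ordered_simplex t) :
  tuple_row t = delta_mx 0 (enum_rank (Sub t Dt : ordered_simplex D n)).
Proof.
apply/rowP=> j; rewrite !mxE eqxx /= -[j in RHS]enum_valK (inj_eq enum_rank_inj) eq_sym.
by rewrite -(inj_eq val_inj).
Qed.

Lemma tuple_row_mul (t : n.-tuple V) (f : n.-tuple V -> n.-tuple V) :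
  is_ordered_simplex t -> tuple_row t *m tuple_mx k f = tuple_row (f t).
Proof.
by move=> Dt; rewrite tuple_row_delta -rowE; apply/rowP=> j; rewrite !mxE enum_rankK.
Qed.

Lemma row_tuple_row m (F : 'M[k]_(N, m)) i : row i F = tuple_row (val (enum_val i)) *m F.
Proof.
rewrite rowE; congr (_ *m _); apply/rowP=> j; rewrite !mxE eqxx /=.
by rewrite (inj_eq val_inj) (inj_eq enum_val_inj) eq_sym.
Qed.

Lemma perm_tupleM (s s' : 'S_n) (t : n.-tuple V) :
  @perm_tuple _ _ D n s (@perm_tuple _ _ D n s' t) = @perm_tuple _ _ D n (s * s') t.
Proof. by apply: eq_from_tnth => i; rewrite !tnth_mktuple permM. Qed.

(** A map on ordered chains that descends to the quotient by the orientation relations. There is no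
    division by n!, so it makes sense in every characteristic. *)
Definition alternator : 'M[k]_N := \sum_(s : 'S_n) (-1) ^+ s *: pmx s.

Lemma mul_alternator (s : 'S_n) : pmx s *m alternator = (-1) ^+ s *: alternator.
Proof.
rewrite /alternator mulmx_sumr scaler_sumr [RHS](reindex_inj (mulIg s)) /=.
apply: eq_bigr => s' _; rewrite -scalemxAr tuple_mxM; last exact: perm_tuple_simplex.
rewrite scalerA odd_permM signr_addb mulrCA -expr2 sqrr_sign mulr1; congr (_ *: tuple_mx _ _).
by apply/funext=> t; rewrite -perm_tupleM.
Qed.

Local Notation rel := (orientation_relations k D n).

Lemma orientation_relations_alternator : rel *m alternator = 0.
Proof.
apply/sub_kermxP/sumsmx_subP=> s _; apply/sub_kermxP.
by rewrite mulmxBl mul_alternator mul_scalar_mx subrr.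
Qed.

Definition chain_quotient : 'M[k]_(N, rdegree (chain k D n)) := in_factmod rel 1%:M.
Local Notation q := chain_quotient.

Lemma chain_quotient_hom : @module_hom _ _ _ OC (chain k D n) q.
Proof.
move=> g Gg; rewrite /q -[RHS](in_factmodJ (orientation_relations_module k D n)) // mul1mx.
by rewrite [RHS]in_factmodE.
Qed.

Lemma chain_quotient_full : row_full q.
Proof.
apply/row_fullP; exists (val_factmod 1%:M); rewrite -in_factmodE.
exact: val_factmodK.
Qed.

Lemma chain_quotient_perm (s : 'S_n) : pmx s *m q = (-1) ^+ s *: q.
Proof.
apply/eqP; rewrite -subr_eq0 -mul_scalar_mx -mulmxBl -in_factmodE in_factmod_eq0.
by rewrite (sumsmx_sup s).
Qed.

(** The alternator kills the relations, hence factors through the quotient; [A] is its composite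
    with a k-linear section of [q]. *)
Lemma chain_quotient_alternator : exists A, alternator = q *m A.
Proof.
exists (val_factmod 1%:M *m alternator).
have [B relB] : exists B, val_submod (in_submod rel (1%:M : 'M[k]_N)) = B *m rel.
  exact/submxP/val_submodP.
rewrite -[LHS]mul1mx -[X in X *m _](add_sub_fact_mod rel) mulmxDl relB -mulmxA.
by rewrite orientation_relations_alternator mulmx0 add0r mulmxA -val_factmodE.
Qed.

(** * Evaluation at the orbit representatives *)

Variables (X : {set {set V}}) (repsX : orbit_reps X) (S : representation k G).
Let Xn := [set s in X | #|s| == n].

Lemma size_rep_tuple (i : 'I_#|Xn|) : size (enum (enum_val i : {set V})) == n.
Proof. by have := enum_valP i; rewrite inE -cardE => /andP[]. Qed.

(** The order given by [enum] is an arbitrary choice of orientation of each representative. *)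
Definition rep_tuple (i : 'I_#|Xn|) : n.-tuple V := Tuple (size_rep_tuple i).

Lemma rep_in (i : 'I_#|Xn|) : enum_val i \in X.
Proof. by have := enum_valP i; rewrite inE => /andP[]. Qed.

Lemma set_rep_tuple i : [set v in rep_tuple i]%SET = enum_val i.
Proof. by apply/setP=> v; rewrite inE mem_enum. Qed.

Lemma rep_tuple_simplex i : is_ordered_simplex (rep_tuple i).
Proof.
rewrite /is_ordered_simplex set_rep_tuple (orbit_reps_simplex repsX (rep_in i)) andbT.
exact: enum_uniq.
Qed.

Local Notation mv g := (@move_tuple _ _ D n g).

Lemma set_move_tuple g t : [set v in mv g t]%SET = (to^*)%act [set v in t]%SET g.
Proof.
apply/setP=> v; rewrite inE; apply/mapP/imsetP => -[w tw ->].
  by exists w => //; rewrite inE.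
by exists w => //; rewrite inE in tw.
Qed.

Lemma set_perm_tuple (s : 'S_n) t :
  [set v in @perm_tuple _ _ D n s t]%SET = [set v in t]%SET.
Proof.
apply/setP=> v; rewrite !inE; apply/mapP/tnthP => [[i _ ->]|[i ->]].
  by exists (s i).
by exists (s^-1 i)%g; rewrite ?mem_enum ?permKV.
Qed.

(** By admissibility the stabilizer fixes every vertex, so it preserves the ordering and not only
    the underlying set. *)
Lemma rep_tuple_stab i h : h \in simplex_stab (enum_val i) -> mv h (rep_tuple i) = rep_tuple i.
Proof.
move=> Hh; apply: val_inj => /=; rewrite -[RHS]map_id; apply/eq_in_map=> v.
rewrite mem_enum; exact: simplex_stab_fix (orbit_reps_simplex repsX (rep_in i)) Hh.
Qed.

Lemma ordered_simplex_rep t : is_ordered_simplex t ->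
  exists i, exists2 g, g \in G & exists s, t = @perm_tuple _ _ D n s (mv g (rep_tuple i)).
Proof.
move=> /andP[ut Dt]; have [s Xs [g Gg sg]] := orbit_reps_orbit repsX Dt.
have cs : #|s| == n.
  rewrite -(card_imset s (act_inj to g)) -setactE sg.
  by rewrite cardsE (card_uniqP ut) size_tuple.
have Xns : s \in Xn by rewrite inE Xs.
exists (enum_rank_in Xns s), g => //.
suff /tuple_permP[p tp] : perm_eq t (mv g (rep_tuple (enum_rank_in Xns s))).
  by exists p; apply: val_inj.
apply: uniq_perm => // [|v].
  by rewrite map_inj_uniq ?enum_uniq //; apply: act_inj.
have := set_move_tuple g (rep_tuple (enum_rank_in Xns s)).
rewrite set_rep_tuple enum_rankK_in // sg => /setP/(_ v).
by rewrite !inE => ->.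
Qed.

(* Evaluation at one ordering of each representative: it embeds the projective
   maps from the chains to S into #|Xn| copies of S, with image the direct sum
   of the subspaces S * norm_mx S G_s. *)
Definition eval_mx : 'M[k]_(#|Xn|, N) := \matrix_i tuple_row (rep_tuple i).

Lemma row_eval_mx m (F : 'M[k]_(N, m)) i :
  row i (eval_mx *m F) = tuple_row (rep_tuple i) *m F.
Proof. by rewrite row_mul rowK. Qed.

Lemma tuple_row_move (g : gT) t : is_ordered_simplex t ->
  tuple_row t *m OC g = tuple_row (mv g t).
Proof. exact: tuple_row_mul. Qed.

(** The coefficient of [S g] in the trace depends only on the left coset of g modulo the stabilizer,
    because the stabilizer fixes [rep_tuple i]. *)
Lemma eval_trace_sub (F : 'M[k]_(rdegree OC, rdegree S)) i :
  (row i (eval_mx *m trace_hom F) <= norm_mx S (simplex_stab (enum_val i)))%MS.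
Proof.
rewrite row_eval_mx mulmx_sumr.
rewrite (eq_bigr (fun g => tuple_row (rep_tuple i) *m OC g^-1%g *m F *m S g)); last first.
  by move=> g _; rewrite !mulmxA.
apply: sum_coset_submx => [|g h Gg Hh]; first exact: simplex_stab_sub.
have Gh : h \in G by apply: fintype.subsetP Hh; apply: simplex_stab_sub.
rewrite invMg repr_mxM ?groupV // mulmxA; congr (_ *m _ *m _).
by rewrite tuple_row_move ?rep_tuple_simplex // rep_tuple_stab // groupV.
Qed.

(** Every ordered simplex is a reordering of a translate of a representative: reordering only
    changes the sign in the quotient, and equivariance takes care of the translation. *)
Lemma eval_inj (F : 'M[k]_(rdegree (chain k D n), rdegree S)) :
  module_hom F -> eval_mx *m q *m F = 0 -> F = 0.
Proof.
move=> homF evF; apply: (mulmx_injl chain_quotient_full); rewrite mulmx0.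
have homqF : @module_hom _ _ _ OC S (q *m F) by apply: module_homM chain_quotient_hom homF.
apply/row_matrixP=> j; rewrite row_tuple_row row0.
have [i [g Gg [s ->]]] := ordered_simplex_rep (valP (enum_val j)).
have Di := rep_tuple_simplex i.
rewrite -tuple_row_mul; last exact: move_tuple_simplex.
rewrite -mulmxA (mulmxA (pmx s)) chain_quotient_perm -scalemxAl -scalemxAr.
rewrite -tuple_row_move // -mulmxA homqF // mulmxA.
by rewrite -row_eval_mx mulmxA evF row0 mul0mx scaler0.
Qed.

Lemma tuple_row_eval t j : is_ordered_simplex t ->
  (tuple_row t *m eval_mx^T) 0 j = (t == rep_tuple j)%:R.
Proof.
move=> Dt; rewrite tuple_row_delta // -rowE !mxE enum_rankK /=.
by rewrite eq_sym.
Qed.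

(** A reordering of the translate by [g] of representative [i] equals some [rep_tuple j] only if
    [j = i] and [g] stabilizes the simplex; then only the identity reordering contributes, with sign
    1. *)
Lemma alternator_eval i g : g \in G ->
  tuple_row (mv g (rep_tuple i)) *m alternator *m eval_mx^T
   = (g \in simplex_stab (enum_val i))%:R *: delta_mx 0 i.
Proof.
move=> Gg; have Di := rep_tuple_simplex i; apply/rowP=> j.
have Dgi : is_ordered_simplex (mv g (rep_tuple i)) by apply: move_tuple_simplex.
have -> : (tuple_row (mv g (rep_tuple i)) *m alternator *m eval_mx^T) 0 j
    = \sum_(s : 'S_n) (-1) ^+ s
        * (@perm_tuple _ _ D n s (mv g (rep_tuple i)) == rep_tuple j)%:R.
  rewrite mulmx_sumr mulmx_suml summxE; apply: eq_bigr => s _.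
  rewrite -scalemxAr -scalemxAl mxE tuple_row_mul //; congr (_ * _).
  by rewrite tuple_row_eval //; apply: perm_tuple_simplex.
rewrite !mxE eqxx /=; case: (boolP (g \in simplex_stab _)) => [Hg | nHg]; last first.
  rewrite mul0r big1 // => s _; case: eqP => [e|]; last by rewrite mulr0.
  (* Reordering keeps the vertex set, so a match means that [g] moves representative [i] to
     representative [j]; these are then equal. *)
  have eij : enum_val i = enum_val j.
    apply: (orbit_reps_uniq repsX (rep_in i) (rep_in j) Gg).
    by rewrite -!set_rep_tuple -set_move_tuple -e set_perm_tuple.
  case/negP: nHg; apply: mem_simplex_stab => //.
  by rewrite [RHS]eij -!set_rep_tuple -set_move_tuple -e set_perm_tuple.
rewrite mul1r rep_tuple_stab // (bigD1 1%g) //= odd_perm1 expr0 mul1r.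
have -> : @perm_tuple _ _ D n 1 (rep_tuple i) = rep_tuple i.
  by apply: eq_from_tnth => l; rewrite tnth_mktuple perm1.
rewrite big1 ?addr0.
  congr ((nat_of_bool _)%:R); apply/eqP/eqP => [e | ->] //.
  by apply: enum_val_inj; rewrite -!set_rep_tuple e.
(* The vertices of a representative are distinct, so a nontrivial reordering changes its tuple. *)
move=> s ns; case: eqP => [e|]; last by rewrite mulr0.
case/eqP: ns; apply/permP=> l; rewrite perm1.
have ut : uniq (rep_tuple i) by case/andP: Di.
have eij : j = i by apply: enum_val_inj; rewrite -!set_rep_tuple -e set_perm_tuple.
apply: (tuple_uniqP _ ut); have := congr1 (fun t : n.-tuple V => tnth t l) e.
by rewrite eij tnth_mktuple.
Qed.

Lemma dim_trace_homs_chain :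
  \dim (trace_homs (chain k D n) S)
    = (\sum_(s in Xn) \rank (norm_mx S (simplex_stab s)))%N.
Proof.
pose E : 'M[k]_(#|Xn|, rdegree (chain k D n)) := eval_mx *m q.
have trE (F : 'M[k]_(_, rdegree S)) :
    E *m trace_hom F = eval_mx *m @trace_hom _ _ _ OC S (q *m F).
  by rewrite (trace_hom_mull _ chain_quotient_hom) mulmxA.
pose V1 := trace_homs (chain k D n) S.
have kerE : (V1 :&: lker (linfun (mulmx E)))%VS = 0%VS.
  apply/eqP; rewrite -subv0; apply/subvP=> F; rewrite memv_cap memv_ker lfunE /=.
  case/andP=> /memv_limg_linfun[F0 ->] /eqP; rewrite memv0 => EF0; apply/eqP.
  by apply: eval_inj EF0; apply: trace_hom_module_hom.
rewrite -(limg_dim_eq kerE) (@dim_row_submx _ _ _ _ (fun i => norm_mx S (simplex_stab (enum_val i)))).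
  by rewrite [RHS]big_enum_val.
move=> A; split=> [/memv_imgP[_ /memv_limg_linfun[F ->] ->] i | rowA].
  by rewrite lfunE /= trE eval_trace_sub.
have [w wE] : exists w : 'I_#|Xn| -> 'rV[k]_(rdegree S),
    forall i, row i A = w i *m norm_mx S (simplex_stab (enum_val i)).
  exists (fun i => row i A *m pinvmx (norm_mx S (simplex_stab (enum_val i)))) => i.
  by rewrite mulmxKpV.
have [B BE] := chain_quotient_alternator.
(* Precomposed with [q], this map alternates a tuple, reads the coefficient of each representative
   and sends it to [w i]. In the trace evaluated at representative [i], only the stabilizer
   survives, leaving [w i] times its norm. *)
pose F : 'M[k]_(_, rdegree S) := B *m eval_mx^T *m \matrix_i w i.
apply/memv_imgP; exists (trace_hom F); first by apply/memv_limg_linfun; exists F.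
rewrite lfunE /= trE; apply/row_matrixP=> i; rewrite wE row_eval_mx mulmx_sumr.
rewrite /norm_mx mulmx_sumr; set H := simplex_stab (enum_val i).
have termE g : g \in G -> tuple_row (rep_tuple i) *m (OC g^-1%g *m (q *m F) *m S g)
    = (g \in H)%:R *: (w i *m S g).
  have qF : q *m F = alternator *m eval_mx^T *m \matrix_i w i by rewrite BE /F !mulmxA.
  move=> Gg; rewrite qF !mulmxA tuple_row_move ?rep_tuple_simplex //.
  rewrite alternator_eval ?groupV // -!scalemxAl; congr (_ *: (_ *m _)).
  by rewrite -rowE rowK.
rewrite [RHS](eq_bigr _ termE) [RHS](bigID [in H]) /= [X in _ + X]big1 ?addr0; last first.
  by move=> g /andP[_ /negPf->]; rewrite scale0r.
apply: eq_big => [g | g ->]; last by rewrite scale1r.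
by rewrite !inE; case: (g \in G).
Qed.

End Chains.

(** * Comparison of the two multiplicities *)

(** This is the multiplicity formula over [H] for the trivial module, whose endomorphism ring has
    dimension 1. *)
Lemma mult_cover_trivial (k : fieldType) (gT : finGroupType) (G H : {group gT})
    (sHG : H \subset G) (S : representation k G) (Pk : representation k H) :
    projective_cover Pk (trivial_module k H) ->
  summand_mult Pk (restrict sHG S) = \rank (norm_mx S H).
Proof.
move=> coverk; rewrite -[LHS]muln1 -(dim_End_trivial k H).
by rewrite (mult_cover_dim_End _ (trivial_module_irr k H) coverk) dim_trace_homs_trivial.
Qed.

Theorem lemma8p1 (R : realType) (k : fieldType) (p : nat)
    (charkp : p \in [pchar k])
    (gT : finGroupType) (G : {group gT}) (D : Gcomplex G)
    (HD : weak_synthetic_building D R p)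
    (S : representation k G) (simpleS : mx_irreducible S)
    (PS : representation k G) (coverS : projective_cover PS S)
    (X : {set {set gvertex D}}) (repsX : orbit_reps X)
    (Pk : forall s : {set gvertex D}, representation k (simplex_stab s))
    (coverk : forall s, s \in X ->
       projective_cover (Pk s) (trivial_module k (simplex_stab s))) :
  (reduced_lefschetz D PS)%:~R =
    (\sum_(s in X) (-1) ^ simplex_dim s *
        (summand_mult (Pk s) (restrict (simplex_stab_sub s) S))%:Z)%:~R
      / (dim_End S)%:R :> rat.
Proof.
have dS_neq0 : (dim_End S)%:R != 0 :> rat.
  by rewrite pnatr_eq0 -lt0n dim_End_gt0.
apply: (canRL (mulfK dS_neq0)); rewrite pmulrn -intrM; congr (_%:~R).
rewrite mulr_suml.
(* The representatives are grouped by their number of vertices, one more than the dimension. It is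
   at most [#|gvertex D|], so [inord] does not alter it. *)
rewrite [RHS](partition_big (fun s : {set gvertex D} => inord #|s| : 'I_#|gvertex D|.+1) predT) //=.
(* The identity holds degree by degree: up to sign, both sides are the dimension of the space of
   projective maps from the chains to [S]. *)
apply: eq_bigr => n _; rewrite -mulrA -PoszM (mult_cover_dim_End _ simpleS coverS).
rewrite (dim_trace_homs_chain n repsX) (big_morph Posz PoszD (erefl _)) mulr_sumr.
apply: eq_big => [s | s].
  rewrite inE; congr (_ && _); rewrite -(inj_eq val_inj) /= inordK //.
  by rewrite ltnS max_card.
by rewrite inE => /andP[Xs /eqP sn]; rewrite /simplex_dim sn (mult_cover_trivial _ _ (coverk s Xs)).
Qed.
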